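(* Let $d \ge 1$ and let $\alpha \in \mathbb{R}^d$ be a totally irrational vector. Let $A, B \subset \mathbb{R}^d$ be two bounded remainder sets with respect to $\alpha$, and suppose that $A$ and $B$ have the same Lebesgue measure. Then $A$ and $B$ are equidecomposable up to measure zero with measurable pieces, using translations by vectors in $\mathbb{Z}\alpha + \mathbb{Z}^d$.
   Context: A vector $\alpha = (\alpha_1, \dots, \alpha_d) \in \mathbb{R}^d$ is totally irrational if the numbers $1, \alpha_1, \dots, \alpha_d$ are linearly independent over the rationals. For a bounded (Lebesgue) measurable set $A \subset \mathbb{R}^d$ put $\chi_A(x) = \sum_{m \in \mathbb{Z}^d} \mathbf{1}_A(x+m)$ for $x \in \mathbb{R}^d$, where $\mathbf{1}_A$ is the indicator function of $A$, and let $\operatorname{mes} A$ denote the Lebesgue measure of $A$. A bounded measurable set $A \subset \mathbb{R}^d$ is called a bounded remainder set with respect to $\alpha$ if there is a constant $C = C(A,\alpha)$ such that for almost every $x \in \mathbb{R}^d$ one has $\left| \sum_{k=0}^{n-1} \chi_A(x + k\alpha) - n \operatorname{mes} A \right| \le C$ for all $n = 1, 2, 3, \dots$. Let $G$ be a countable subgroup of $\mathbb{R}^d$. Two measurable sets $A, B \subset \mathbb{R}^d$ are equidecomposable up to measure zero with measurable pieces, using translations by vectors in $G$, if there exist finitely many measurable sets $A_1, \dots, A_n \subset \mathbb{R}^d$, vectors $g_1, \dots, g_n \in G$, and a set $X' \subset \mathbb{R}^d$ whose complement has Lebesgue measure zero, such that $\{A_j \cap X'\}_{j=1}^n$ is a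 partition of $A \cap X'$ and $\{(A_j + g_j) \cap X'\}_{j=1}^n$ is a partition of $B \cap X'$. *)

(* Defs.v *)
From HB Require Import structures.
From mathcomp Require Import all_boot all_order all_algebra.
From mathcomp Require Import all_classical all_reals all_analysis.

Set Implicit Arguments.
Unset Strict Implicit.
Unset Printing Implicit Defensive.

Import Order.TTheory GRing.Theory Num.Theory.
Import numFieldNormedType.Exports.

Local Open Scope classical_set_scope.
Local Open Scope ring_scope.

Section lebesgue_outer.
Variables (R : realType) (d : nat).
Local Notation V := 'rV[R]_d.

Definition box (a b : V) : set V := [set x | forall i, a 0 i < x 0 i <= b 0 i].

Definition box_volume (a b : V) : R := \prod_(i < d) Num.max 0 (b 0 i - a 0 i).

Lemma box_volume_ge0 (a b : V) : 0 <= box_volume a b.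
Proof. by apply: prodr_ge0 => i _; rewrite le_max lexx. Qed.

(* A cover is indexed by an arbitrary set D of naturals, so that it can be
   empty: when d = 0 no box is empty. *)
Definition box_cover (A : set V) (D : set nat) (a b : nat -> V) : Prop :=
  A `<=` \bigcup_(k in D) box (a k) (b k).

Definition lebesgue_outer (A : set V) : \bar R :=
  ereal_inf [set s | exists (D : set nat) (a b : nat -> V),
    box_cover A D a b /\ s = \esum_(k in D) (box_volume (a k) (b k))%:E]%E.

Local Open Scope ereal_scope.

Lemma lebesgue_outer_ge0 A : 0 <= lebesgue_outer A.
Proof.
apply: le_ereal_inf_tmp => _ [D [a [b [_ ->]]]].
by apply: esum_ge0 => k _; rewrite lee_fin box_volume_ge0.
Qed.

Lemma lebesgue_outer0 : lebesgue_outer set0 = 0.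
Proof.
apply/eqP; rewrite eq_le lebesgue_outer_ge0 andbT.
apply: ereal_inf_lbound; exists set0, (fun=> 0%R), (fun=> 0%R).
by split; [exact: sub0set | rewrite esum_set0].
Qed.

Lemma le_lebesgue_outer : {homo lebesgue_outer : A B / A `<=` B >-> A <= B}.
Proof.
move=> A B AB; apply: ereal_inf_le_tmp => s [D [a [b [cB ->]]]].
by exists D, a, b; split => //; exact: subset_trans cB.
Qed.

Lemma lebesgue_outer_sigma_subadditive : sigma_subadditive lebesgue_outer.
Proof.
move=> A; have [[i ioo]|] := pselect (exists i, lebesgue_outer (A i) = +oo).
  rewrite (eseries_pinfty _ _ ioo) ?leey// => n _.
  by rewrite -ltNye (lt_le_trans _ (lebesgue_outer_ge0 _)).
rewrite -forallNE => Aoo.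
apply/lee_addgt0Pr => e e0.
rewrite (le_trans _ (epsilon_trick _ _ (ltW e0)))//; last first.
  by move=> n; exact: lebesgue_outer_ge0.
have [G PG] : {G : nat -> set nat * ((nat -> V) * (nat -> V)) & forall n,
    box_cover (A n) (G n).1 (G n).2.1 (G n).2.2 /\
    \esum_(k in (G n).1) (box_volume ((G n).2.1 k) ((G n).2.2 k))%:E <=
      lebesgue_outer (A n) + (e / (2 ^ n.+1)%:R)%:E}.
  apply: (@choice _ _ (fun n g => box_cover (A n) g.1 g.2.1 g.2.2 /\
    \esum_(k in g.1) (box_volume (g.2.1 k) (g.2.2 k))%:E <=
      lebesgue_outer (A n) + (e / (2 ^ n.+1)%:R)%:E)) => n.
  have en : (0 < e / (2 ^ n.+1)%:R)%R by rewrite divr_gt0// ltr0n expn_gt0.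
  have fA : lebesgue_outer (A n) \is a fin_num.
    rewrite ge0_fin_numE ?lebesgue_outer_ge0// ltey; exact/eqP/Aoo.
  have [_ [D [a [b [cA ->]]]] /ltW le] := lb_ereal_inf_adherent en fA.
  by exists (D, (a, b)).
have /card_esym/ppcard_eqP[f] := card_nat2.
pose v (p : nat * nat) : \bar R :=
  (box_volume ((G p.1).2.1 p.2) ((G p.1).2.2 p.2))%:E.
have v0 p : 0 <= v p by rewrite lee_fin box_volume_ge0.
pose E : set (nat * nat) := [set p | (G p.1).1 p.2].
apply: (@le_trans _ _ (\esum_(p in E) v p)).
  apply: ereal_inf_lbound.
  exists (f @^-1` E), (fun k => (G (f k).1).2.1 (f k).2),
    (fun k => (G (f k).1).2.2 (f k).2); split.
    move=> t [n _ Ant]; have [k Gk tk] := (PG n).1 _ Ant.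
    exists (f^-1%FUN (n, k)); by rewrite /E /= invK ?inE//.
  apply: reindex_esum => //.
  split; first by move=> k.
    apply: in2W; apply: (@can_inj _ _ f (f^-1)%FUN) => k.
    by rewrite funK ?inE.
  by move=> p Ep; exists (f^-1%FUN p); rewrite ?/= ?invK ?inE.
have -> : \esum_(p in E) v p =
    \esum_(n in setT) \esum_(k in (G n).1) v (n, k).
  rewrite esum_esum; last by move=> n k _ _; exact: v0.
  have -> : E = setT `*`` (fun n => (G n).1).
    by apply/seteqP; split => [[n k] //=|[n k] []].
  by apply: eq_esum => -[n k].
rewrite -nneseries_esumT; last by move=> n; apply: esum_ge0.
apply: lee_nneseries => n; first by move=> *; exact: esum_ge0.
by move=> _; exact: (PG n).2.
Qed.

HB.instance Definition _ := isOuterMeasure.Build R V lebesgue_outer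
  lebesgue_outer0 lebesgue_outer_ge0 le_lebesgue_outer
  lebesgue_outer_sigma_subadditive.

End lebesgue_outer.

(* Lebesgue measure on the Lebesgue (= Caratheodory measurable) subsets of R^d,
   not only on the Borel ones. *)
Definition lebesgue_rV (R : realType) (d : nat) :
    set (caratheodory_type (@lebesgue_outer R d)) -> \bar R :=
  @lebesgue_outer R d.

HB.instance Definition _ (R : realType) (d : nat) :=
  isMeasure.Build _ _ _ (@lebesgue_rV R d)
    (caratheodory_measure0 _)
    (@caratheodory_measure_ge0 _ _ _)
    (@caratheodory_measure_sigma_additive _ _ _).

Section bounded_remainder.
Variables (R : realType) (d : nat).
Local Notation V := 'rV[R]_d.

Definition lebesgue_measurable (A : set V) : Prop :=
  (@lebesgue_outer R d).-cara.-measurable A.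

Definition totally_irrational (alpha : V) : Prop :=
  forall (q0 : rat) (q : 'I_d -> rat),
    ratr q0 + \sum_(i < d) ratr (q i) * alpha 0 i = 0 ->
    q0 = 0 /\ forall i, q i = 0.

Definition int_vec (m : 'rV[int]_d) : V := map_mx intr m.

(* The sum over Z^d is [\sum_(m \in _)] of fsbigop, which is 0 when infinitely
   many terms are nonzero; this does not happen for bounded A. *)
Definition multiplicity (A : set V) (x : V) : R :=
  \sum_(m \in [set: 'rV[int]_d]) (\1_A (x + int_vec m) : R).

Definition bounded_remainder_set (alpha : V) (A : set V) : Prop :=
  [/\ bounded_set A, lebesgue_measurable A &
    exists C : R, {ae @lebesgue_rV R d, forall x : V,
      forall n : nat, (0 < n)%N ->
        `| \sum_(k < n) multiplicity A (x + alpha *+ k)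
           - n%:R * fine (lebesgue_rV A) | <= C} ].

(* Unlike [partition] of classical_sets, blocks may be empty. *)
Definition indexed_partition n (F : 'I_n -> set V) (A : set V) : Prop :=
  trivIset setT F /\ \bigcup_(j in setT) F j = A.

Definition equidecomposable (G A B : set V) : Prop :=
  exists (n : nat) (P : 'I_n -> set V) (g : 'I_n -> V) (X : set V),
    [/\ forall j, lebesgue_measurable (P j),
        forall j, G (g j),
        lebesgue_rV (~` X) = 0%E,
        indexed_partition (fun j => P j `&` X) (A `&` X) &
        indexed_partition (fun j => [set x + g j | x in P j] `&` X) (B `&` X)].

Definition rotation_group (alpha : V) : set V :=
  [set g | exists (k : int) (m : 'rV[int]_d), g = alpha *~ k + int_vec m].

End bounded_remainder.

(* Main.v *)
Require Import Defs.
From mathcomp Require Import finmap.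
From mathcomp Require Import all_boot all_order all_algebra.
From mathcomp Require Import all_classical all_reals all_analysis.
From mathcomp Require Import measurable_realfun zify lra.

Set Implicit Arguments.
Unset Strict Implicit.
Unset Printing Implicit Defensive.

Import Order.TTheory GRing.Theory Num.Theory.
Import numFieldNormedType.Exports.

Local Open Scope classical_set_scope.
Local Open Scope ring_scope.

(** Project the sets to the torus R^d / Z^d and follow an orbit x, x + alpha,
    x + 2 alpha, ... . Each passage through A (counted with multiplicity) is a
    customer joining a queue, each passage through B serves one customer. Both
    sets have the same measure and bounded remainder, so the difference of the
    two visit counts up to time n, S_n B x - S_n A x, is bounded in n for almost
    every x. Hence
        u x = K + limsup_n (S_n B x - S_n A x)
    is a bounded natural number for a suitable constant K, and comparing the
    orbits of x and of x + alpha gives exactly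
        u (x + alpha) + visits B x = u x + visits A x :
    u is a stationary queue length. (In the language of dynamics, the difference
    of the two multiplicity functions is a coboundary with bounded transfer
    function u; the limsup provides u without any compactness or ergodicity.)

    Serve the queue first in, first out: a customer that arrives at time 0 with
    u x + i customers ahead is served by the visit to B that has number u x + i,
    counting from 0. This is a bijection between arrivals and services: given
    the first customer, [slot_exists] and [slot_unique] locate the service by
    adding up visits to B forward in time; given the service, the same two
    lemmas locate the customer by adding up visits to A backward in time
    ([matched_backward]). When the common measure is positive, every long enough
    window contains more visits than the queue can hold, so the waiting time is
    bounded; as A and B are bounded sets, the translation t alpha + m taking a
    customer to its service then ranges over a finite set. The pieces are the
    sets of points of A with a given translation.

    To speak of the i-th visit at a given time one needs an order on the points
    of a fibre x + Z^d that does not depend on the choice of x and is measurable.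
    The order by the linear form m |-> sum_i m_i alpha_i is one; it separates
    integer vectors because alpha is totally irrational.

    If the common measure is zero, no piece is needed. *)

(** * Counting lemmas *)

Section slots.
Local Open Scope nat_scope.

(** If g k visitors come at time k and all are numbered consecutively, then
    number s is the j-th visitor of one particular time t. *)
Lemma slot_exists (g : nat -> nat) (T s : nat) : s < \sum_(k < T) g k ->
  exists t j, [/\ t < T, j < g t & \sum_(k < t) g k + j = s].
Proof.
elim: T => [|T IH]; first by rewrite big_ord0.
rewrite big_ord_recr /=.
have [/IH [t [j [tT jg e]]] _|le sT] := ltnP s (\sum_(k < T) g k).
  by exists t, j; split => //; exact: ltnW.
exists T, (s - \sum_(k < T) g k); split; [by []| |exact: subnKC].
by rewrite ltn_subLR.
Qed.

Lemma slot_unique (g : nat -> nat) (t j t' j' : nat) : j < g t -> j' < g t' ->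
  \sum_(k < t) g k + j = \sum_(k < t') g k + j' -> t = t' /\ j = j'.
Proof.
have lt_sum t1 t2 j1 j2 : t1 < t2 -> j1 < g t1 ->
    \sum_(k < t1) g k + j1 < \sum_(k < t2) g k + j2.
  move=> lt12 j1g; rewrite -(subnKC lt12) big_split_ord /= big_ord_recr /=.
  by rewrite -2!addnA ltn_add2l ltn_addr.
move=> jg jg' e; have [tt|tt|tt] := ltngtP t t'.
- by have := lt_sum _ _ j j' tt jg; rewrite e ltnn.
- by have := lt_sum _ _ j' j tt jg'; rewrite e ltnn.
- by subst t'; split => //; apply/eqP; rewrite -(eqn_add2l (\sum_(k < t) g k)) e.
Qed.

End slots.

Lemma card_fset_set_lt {K : choiceType} (S S' : set K) m : finite_set S' ->
  S `<=` S' -> S' m -> ~ S m -> (#|` fset_set S| < #|` fset_set S'|)%N.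
Proof.
move=> fS' SS' S'm nSm; have fS : finite_set S by exact: sub_finite_set fS'.
apply: fproper_ltn_card; rewrite fproperE; apply/andP; split.
  by apply/fsubsetP => x; rewrite !in_fset_set// !inE; exact: SS'.
apply/negP => /fsubsetP/(_ m); rewrite !in_fset_set// !inE => H.
by apply: nSm; exact: H.
Qed.

Section rank.
Context {K : choiceType} {R : realDomainType}.
Variable key : K -> R.

Definition rank (S : set K) (m : K) : nat :=
  #|` fset_set (S `&` [set m' | key m' < key m]) |.

Lemma rank_lt_card S m : finite_set S -> S m -> (rank S m < #|` fset_set S|)%N.
Proof.
move=> fS Sm; apply: (@card_fset_set_lt _ _ _ m) => //=.
by case; rewrite ltxx.
Qed.

Lemma rank_inj S m m' : injective key -> finite_set S -> S m -> S m' ->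
  rank S m = rank S m' -> m = m'.
Proof.
move=> ki fS; have lt m1 m2 : S m1 -> key m1 < key m2 ->
    (rank S m1 < rank S m2)%N.
  move=> S1 lt12; apply: (@card_fset_set_lt _ _ _ m1) => //=.
  - exact: finite_setIl.
  - by move=> x /= [Sx xm]; split => //; exact: lt_trans lt12.
  - by case; rewrite ltxx.
move=> Sm Sm' e; apply: ki; have [/lt|/lt|//] := ltgtP (key m) (key m').
- by move=> /(_ Sm); rewrite e ltnn.
- by move=> /(_ Sm'); rewrite e ltnn.
Qed.

(** Ranks are distinct and smaller than the cardinal, so they exhaust the
    numbers below it. *)
Lemma rank_surj S i : injective key -> finite_set S ->
  (i < #|` fset_set S|)%N -> exists2 m, S m & rank S m = i.
Proof.
move=> ki fS iS; have sub m : m \in fset_set S -> S m.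
  by rewrite in_fset_set ?inE.
have : i \in iota 0 #|` fset_set S| by rewrite mem_iota.
have [| | |_ <-] := @uniq_min_size _ [seq rank S m | m <- fset_set S]
    (iota 0 #|` fset_set S|).
- rewrite map_inj_in_uniq ?fset_uniq// => m m' /sub Sm /sub Sm'.
  exact: rank_inj.
- by move=> _ /mapP[m /sub Sm ->]; rewrite mem_iota add0n rank_lt_card.
- by rewrite size_iota size_map.
by move=> /mapP[m /sub Sm ->]; exists m.
Qed.
End rank.

(** For a bounded sequence of natural numbers the upper limit is the largest
    value taken infinitely often; in this form it is visibly a natural number and
    a countable combination of conditions on the terms. *)
Definition is_limsup (s : nat -> nat) (v : nat) : Prop :=
  (forall N, exists2 n, (N <= n)%N & s n = v) /\
  (exists N, forall n, (N <= n)%N -> (s n <= v)%N).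

Lemma is_limsup_ex s M : (forall n, (s n <= M)%N) -> exists v, is_limsup s v.
Proof.
suff H : forall M, (exists N, forall n, (N <= n)%N -> (s n <= M)%N) ->
    exists v, is_limsup s v.
  by move=> sM; apply: (H M); exists 0.
elim => [[N sN]|M' IH [N sN]].
- exists 0%N; split; last by exists N.
  move=> N'; exists (maxn N N'); first by rewrite leq_maxr.
  by apply/eqP; rewrite -leqn0 sN ?leq_maxl.
- have [io|] := pselect (forall N, exists2 n, (N <= n)%N & s n = M'.+1).
    by exists M'.+1; split => //; exists N.
  move=> /existsNP[N' nN']; apply: IH; exists (maxn N N') => n.
  rewrite geq_max => /andP[nN nN'']; rewrite -ltnS ltn_neqAle sN// andbT.
  by apply/eqP => e; apply: nN'; exists n.
Qed.

(** The two sequences differ by a constant up to a shift of the index, and the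
    upper limit ignores the shift. This is what turns counts over finite orbits
    into an exact cohomological equation. *)
Lemma is_limsup_shift s s' t p q v v' :
  (forall n, s (t + n) + p = s' n + q)%N ->
  is_limsup s v -> is_limsup s' v' -> (v + p = v' + q)%N.
Proof.
move=> e [io [N le]] [io' [N' le']].
have [n tNn sv] := io (t + N')%N; have [n' Nn' sv'] := io' N.
have tn : (t + (n - t) = n)%N by lia.
have := e (n - t)%N; have := e n'; rewrite tn sv sv'.
have := le (t + n')%N ltac:(lia); have := le' (n - t)%N ltac:(lia); lia.
Qed.

Lemma is_limsup_unique s v v' : is_limsup s v -> is_limsup s v' -> v = v'.
Proof.
move=> [io [N le]] [io' [N' le']].
have [n nN sv] := io N'; have [n' n'N sv'] := io' N.
have := le n' n'N; have := le' n nN; rewrite sv sv'; lia.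
Qed.

(** * Lebesgue outer measure and measurable functions on R^d *)

Section lebesgue.
Context {R : realType} {d : nat}.
Local Notation V := 'rV[R]_d.
Local Notation T := (caratheodory_type (@lebesgue_outer R d)).
Implicit Types (A S : set V) (v : V).

Lemma le_lebesgue_outer_shift A v :
  (lebesgue_outer [set x : V | A (x + v)%R] <= lebesgue_outer A)%E.
Proof.
apply: le_ereal_inf_tmp => _ [D [a [b [cA ->]]]].
apply: ereal_inf_lbound; exists D, (fun k => a k - v), (fun k => b k - v).
split.
  move=> x /cA[k Dk axb]; exists k => // i.
  by have := axb i; rewrite !mxE ltrBlDr lerBrDr.
apply: eq_esum => k _; congr (_%:E); apply: eq_bigr => i _.
by rewrite !mxE opprB addrA subrK.
Qed.

Lemma lebesgue_outer_shift A v :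
  lebesgue_outer [set x | A (x + v)] = lebesgue_outer A.
Proof.
apply/eqP; rewrite eq_le le_lebesgue_outer_shift/=.
have := le_lebesgue_outer_shift [set x | A (x + v)] (- v).
by congr (lebesgue_outer _ <= _)%E; apply/seteqP; split => x /=; rewrite subrK.
Qed.

Lemma lebesgue_measurable_shift A v :
  lebesgue_measurable A -> lebesgue_measurable [set x | A (x + v)].
Proof.
move=> mA; change ((@lebesgue_outer R d).-caratheodory [set x | A (x + v)]).
move=> X; have : (@lebesgue_outer R d).-caratheodory A := mA.
move=> /(_ [set x | X (x - v)]).
rewrite lebesgue_outer_shift => ->; congr (_ + _)%E.
  rewrite -(lebesgue_outer_shift _ v); congr lebesgue_outer.
  by apply/seteqP; split => x /=; rewrite addrK.
rewrite -(lebesgue_outer_shift _ v); congr lebesgue_outer.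
by apply/seteqP; split => x /=; rewrite addrK.
Qed.

Lemma lebesgue_outer_null_bigcup (I : countType) (F : I -> set V) :
  (forall i, lebesgue_outer (F i) = 0%E) -> lebesgue_outer (\bigcup_i F i) = 0%E.
Proof.
move=> F0; pose G n := if @unpickle I n is Some i then F i else set0.
have -> : \bigcup_i F i = \bigcup_n G n.
  apply/seteqP; split => [x [i _ Fx]|x [n _]].
    by exists (pickle i); rewrite // /G pickleK.
  by rewrite /G; case: (@unpickle I n) => // i Fx; exists i.
apply/eqP; rewrite eq_le lebesgue_outer_ge0 andbT.
apply: (le_trans (outer_measure_sigma_subadditive _ G)).
rewrite eseries0// => n _ _.
by rewrite /G; case: (@unpickle I n) => [i|]; [exact: F0|exact: lebesgue_outer0].
Qed.

Lemma ler_coord_norm (x : V) i : `|x 0 i| <= `|x|.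
Proof.
rewrite [leRHS]/Num.Def.normr /= mx_normrE.
by apply/bigmax_geP; right; exists (0, i).
Qed.

Lemma bounded_set_norm_le A : bounded_set A ->
  exists M : R, forall x, A x -> `|x| <= M.
Proof.
by move=> [M [_ AM]]; exists (M + 1) => x; apply: AM; rewrite ltrDl.
Qed.

(** The coordinates of such a vector m lie in the interval from - N to N, so m is
    N subtracted from a vector with entries in the ordinals below 2 N + 1. *)
Lemma finite_int_vec (M : R) :
  finite_set [set m : 'rV[int]_d | `|int_vec R m| <= M].
Proof.
pose N := Num.bound `|M|.
pose dec (c : 'rV['I_(N.*2).+1]_d) : 'rV[int]_d :=
  map_mx (fun k => (nat_of_ord k)%:Z - N%:Z) c.
apply: (@sub_finite_set _ _ (dec @` setT)); last first.
  exact/finite_image/finite_finset.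
move=> m /= mM; exists (map_mx (fun z : int => inord `|(z + N%:Z)%R|%N) m) => //.
apply/rowP => i; rewrite !mxE.
have : `|int_vec R m 0 i| < N%:R.
  apply: le_lt_trans (ler_coord_norm _ _) _; apply: le_lt_trans mM _.
  by apply: le_lt_trans (ler_norm M) _; exact: archi_boundP.
by rewrite mxE -intr_norm pmulrn ltr_int => h; rewrite inordK; lia.
Qed.

Lemma lebesgue_outer_bounded A : bounded_set A -> (lebesgue_outer A < +oo)%E.
Proof.
move=> /bounded_set_norm_le[M AM].
pose a := const_mx (- M - 1) : V; pose b := const_mx M : V.
apply: (@le_lt_trans _ _ (box_volume a b)%:E); last exact: ltey.
apply: ereal_inf_lbound; exists [set 0%N], (fun=> a), (fun=> b); split.
  move=> x Ax; exists 0%N => // i; rewrite !mxE.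
  have := le_trans (ler_coord_norm x i) (AM x Ax).
  rewrite ler_norml => /andP[h ->]; rewrite andbT.
  by apply: lt_le_trans h; rewrite ltrBlDr ltrDl.
by rewrite esum_set1// lee_fin box_volume_ge0.
Qed.

Lemma measurable_fun_natP (f : V -> nat) :
  (forall n, lebesgue_measurable [set x | (n <= f x)%N]) ->
  measurable_fun [set: T] (f : T -> nat).
Proof.
move=> mf _ Y _; rewrite setTI.
have -> : f @^-1` Y = \bigcup_(n in Y)
    ([set x | (n <= f x)%N] `\` [set x | (n.+1 <= f x)%N]).
  apply/seteqP; split => [x Yx|x [n Yn /= [nf fn]]].
    by exists (f x) => //; split => //=; rewrite ltnn.
  by have -> // : f x = n; lia.
by apply: bigcup_measurable => n _; apply: measurableD; exact: mf.
Qed.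

Lemma measurable_fun_shift (f : V -> nat) v :
  measurable_fun [set: T] (f : T -> nat) ->
  measurable_fun [set: T] (fun x : T => f (x + v)).
Proof.
move=> mf; apply: measurable_fun_natP => n.
have := mf measurableT [set k | (n <= k)%N] I.
by rewrite setTI; exact: lebesgue_measurable_shift.
Qed.

Lemma measurable_fun_sumn (I : Type) (r : seq I) (f : I -> T -> nat) :
  (forall i, measurable_fun [set: T] (f i)) ->
  measurable_fun [set: T] (fun x => \sum_(i <- r) f i x)%N.
Proof.
move=> mf; elim: r => [|i r IH].
  by under eq_fun do rewrite big_nil; exact: measurable_cst.
by under eq_fun do rewrite big_cons; exact: measurable_fun_addn.
Qed.

Lemma lebesgue_measurable_eqn (f g : T -> nat) :
  measurable_fun [set: T] f -> measurable_fun [set: T] g ->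
  lebesgue_measurable [set x | f x = g x].
Proof.
move=> mf mg; have := measurable_fun_eqn mf mg measurableT (Y := [set true]) I.
by rewrite setTI; congr lebesgue_measurable; apply/seteqP; split => x /= /eqP.
Qed.

Lemma lebesgue_measurable_limsup (s : nat -> V -> nat) (v : nat) :
  (forall n, measurable_fun [set: T] (s n : T -> nat)) ->
  lebesgue_measurable [set x | is_limsup (s^~ x) v].
Proof.
move=> ms.
have -> : [set x | is_limsup (s^~ x) v] =
    (\bigcap_N \bigcup_(n in [set n | (N <= n)%N]) [set x : T | s n x = v]) `&`
    (\bigcup_N \bigcap_(n in [set n | (N <= n)%N]) [set x : T | (s n x <= v)%N]).
  apply/seteqP; split => [x [io [N le]]|x [io [N _ le]]].
    by split => [N' _|]; [have [n] := io N'; exists n|exists N].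
  by split => [N'|]; [have [n] := io N' I; exists n|exists N].
have mle n : measurable [set x : T | (s n x <= v)%N].
  by have := ms n measurableT [set k | (k <= v)%N] I; rewrite setTI.
apply: measurableI.
  apply: bigcapT_measurable => N; apply: bigcup_measurable => n _.
  by have := ms n measurableT [set v] I; rewrite setTI.
by apply: bigcupT_measurable => N; exact: bigcap_measurableType.
Qed.

End lebesgue.

(** * Visits to a set along a fibre x + Z^d *)

Section fibres.
Context {R : realType} {d : nat}.
Local Notation V := 'rV[R]_d.
Local Notation T := (caratheodory_type (@lebesgue_outer R d)).
Implicit Types (A : set V) (x : V) (m : 'rV[int]_d) (Q : set 'rV[int]_d).

Lemma int_vecD m m' : int_vec R (m + m') = int_vec R m + int_vec R m'.
Proof. exact: map_mxD. Qed.

Lemma int_vecN m : int_vec R (- m) = - int_vec R m.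
Proof. exact: map_mxN. Qed.

Definition fibre A x : set 'rV[int]_d := [set m | A (x + int_vec R m)].

Definition hits A Q x : nat := #|` fset_set (fibre A x `&` Q)|.

Definition visits A x : nat := hits A setT x.

Lemma finite_fibre A x : bounded_set A -> finite_set (fibre A x).
Proof.
move=> /bounded_set_norm_le[M AM].
apply: sub_finite_set (finite_int_vec (M + `|x|)) => m /AM /= le.
have -> : int_vec R m = (x + int_vec R m) - x by rewrite addrC addKr.
by apply: le_trans (ler_normB _ _) _; rewrite lerD2r.
Qed.

Lemma card_fset_set_shift (Z : zmodType) (S : set Z) (m : Z) : finite_set S ->
  #|` fset_set [set z | S (z + m)]| = #|` fset_set S|.
Proof.
move=> fS; have -> : [set z | S (z + m)] = (fun z => z - m) @` S.
  apply/seteqP; split => [z /= Sz|_ [z Sz <-]].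
    by exists (z + m) => //; rewrite addrK.
  by rewrite /= subrK.
rewrite fset_set_image// card_imfset//; exact: addIr.
Qed.

(** Both sides count the same points of A in the same coset of Z^d; only the
    origin from which they are named by integer vectors moves. *)
Lemma hits_shift A Q x m : bounded_set A ->
  hits A [set m' | Q (m' + m)] (x + int_vec R m) = hits A Q x.
Proof.
move=> bA; rewrite /hits -[RHS](card_fset_set_shift m); last first.
  by apply: finite_setIl; exact: finite_fibre.
congr (#|` fset_set _|); apply/seteqP; split => m' /=;
  by rewrite /fibre /= int_vecD [int_vec R m' + _]addrC addrA.
Qed.

Lemma visits_shift A x m : bounded_set A ->
  visits A (x + int_vec R m) = visits A x.
Proof. exact: (@hits_shift A setT). Qed.

Lemma multiplicityE A x : bounded_set A ->
  multiplicity A x = (visits A x)%:R.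
Proof.
move=> bA; rewrite /visits /hits setIT.
transitivity (\sum_(m \in fibre A x) (1 : R)).
  rewrite fsbig_mkcond; apply: eq_fsbigr => m _.
  rewrite indicE /patch.
  have -> : (x + int_vec R m \in A) = (m \in fibre A x).
    by apply/idP/idP; rewrite !inE.
  by case: (m \in fibre A x).
rewrite fsbig_finite; last exact: finite_fibre.
by rewrite big_const_seq count_predT iter_addr_0.
Qed.

(** At least n hits means that some list of n distinct vectors of Q consists of
    hits, and there are only countably many lists of integer vectors. *)
Lemma measurable_hits A Q : bounded_set A -> lebesgue_measurable A ->
  measurable_fun [set: T] (hits A Q : T -> nat).
Proof.
move=> bA mA; apply: measurable_fun_natP => n.
pose good (s : seq 'rV[int]_d) := [/\ uniq s, size s = n & [set` s] `<=` Q].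
pose F (s : seq 'rV[int]_d) : set T :=
  \bigcap_(m in [set` s]) [set x | A (x + int_vec R m)].
have -> : [set x | (n <= hits A Q x)%N] =
    \bigcup_s (if `[< good s >] then F s else set0).
  apply/seteqP; split => [x /= nx|x [s _]].
    pose s := take n (fset_set (fibre A x `&` Q)).
    have sub : [set` s] `<=` fibre A x `&` Q.
      move=> m /= /mem_take; rewrite in_fset_set ?inE//.
      by apply: finite_setIl; exact: finite_fibre.
    exists s => //; rewrite asboolT; first by move=> m /sub[].
    split; [|by rewrite size_takel|by move=> m /sub[]].
    by apply: take_uniq; exact: fset_uniq.
  case: asboolP => // -[us <- sQ] sF.
  apply: uniq_leq_size => // m ms; rewrite in_fset_set ?inE; last first.
    by apply: finite_setIl; exact: finite_fibre.
  by split; [exact: sF|exact: sQ].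
apply: countable_bigcupT_measurable => // s; case: asboolP => // _.
apply: fin_bigcap_measurable; first exact: finite_seq.
by move=> m _; exact: lebesgue_measurable_shift.
Qed.

Section index.
Variable key : 'rV[int]_d -> R.
Hypothesis keyD : {morph key : m m' / m + m'}.
Hypothesis key_inj : injective key.

(** The number of points of A in the coset of x that precede x. This is the rank
    of x in its fibre, written as a function of x alone so that it is
    measurable. *)
Definition fibre_index A : V -> nat := hits A [set m | key m < 0].

Lemma fibre_index_rank A x m : bounded_set A ->
  fibre_index A (x + int_vec R m) = rank key (fibre A x) m.
Proof.
move=> bA; rewrite /rank -/(hits A [set m' | key m' < key m] x).
rewrite -(@hits_shift _ _ x m)//; congr hits.
by apply/seteqP; split => m' /=; rewrite keyD gtrDr.
Qed.

Lemma fibre_index_lt A x : bounded_set A -> A x ->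
  (fibre_index A x < visits A x)%N.
Proof.
move=> bA Ax; have x0 : x = x + int_vec R (0 : 'rV_d).
  by rewrite [int_vec _ _]map_mx0 addr0.
rewrite {1}x0 fibre_index_rank// /visits /hits setIT.
by apply: rank_lt_card; [exact: finite_fibre|rewrite /fibre /= -x0].
Qed.

Lemma fibre_index_surj A x i : bounded_set A -> (i < visits A x)%N ->
  exists2 m, A (x + int_vec R m) & fibre_index A (x + int_vec R m) = i.
Proof.
rewrite /visits /hits setIT => bA /(rank_surj key_inj (finite_fibre x bA)).
by move=> [m Am <-]; exists m => //; exact: fibre_index_rank.
Qed.

Lemma fibre_index_inj A x m m' : bounded_set A ->
  A (x + int_vec R m) -> A (x + int_vec R m') ->
  fibre_index A (x + int_vec R m) = fibre_index A (x + int_vec R m') -> m = m'.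
Proof.
move=> bA Am Am'; rewrite !fibre_index_rank//.
by apply: rank_inj => //; exact: finite_fibre.
Qed.

End index.
End fibres.

(** * First in, first out matching of the visits to A and B *)

Section matching.
Context {R : realType} {d : nat}.
Local Notation V := 'rV[R]_d.
Local Notation T := (caratheodory_type (@lebesgue_outer R d)).
Variables (alpha : V) (key : 'rV[int]_d -> R).
Hypothesis keyD : {morph key : m m' / m + m'}.
Hypothesis key_inj : injective key.
Implicit Types (x y : V) (m : 'rV[int]_d).

Definition orbit_visits (A : set V) x n : nat :=
  \sum_(k < n) visits A (x + alpha *+ k).

Lemma orbit_visitsD A x t n : orbit_visits A x (t + n) =
  (orbit_visits A x t + orbit_visits A (x + alpha *+ t) n)%N.
Proof.
rewrite /orbit_visits big_split_ord /=; congr addn.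
by apply: eq_bigr => k _; rewrite mulrnDr addrA.
Qed.

Lemma orbit_visits1 A x : orbit_visits A x 1 = visits A x.
Proof. by rewrite /orbit_visits big_ord_recl big_ord0 addn0 addr0. Qed.

Lemma orbit_visits_shift A x m n : bounded_set A ->
  orbit_visits A (x + int_vec R m) n = orbit_visits A x n.
Proof.
by move=> bA; apply: eq_bigr => k _; rewrite addrAC visits_shift.
Qed.

Lemma orbit_visits_backward A x n : orbit_visits A (x - alpha *+ n) n.+1 =
  (\sum_(k < n.+1) visits A (x - alpha *+ k))%N.
Proof.
rewrite /orbit_visits (reindex_inj rev_ord_inj) /=; apply: eq_bigr => k _.
rewrite subSS -addrA -{1}(subnK (ltnSE (ltn_ord k))) mulrnDr opprD.
by rewrite addrAC addNr add0r.
Qed.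

Variables (A B : set V) (K : nat).
Hypotheses (bA : bounded_set A) (bB : bounded_set B).

(** The upper limit of this sequence in n is the queue length at x. The constant
    K keeps the truncated subtraction exact and the values nonnegative. *)
Definition queue n x : nat := orbit_visits B x n + K - orbit_visits A x n.

(** The customer a is served t steps later at the point a + t alpha + m: the
    services from time 0 on that precede this point are as many as the customers
    ahead of a, namely the v customers of the queue and the points of A in the
    coset of a that precede a. *)
Definition matched (t : nat) m a : Prop :=
  [/\ A a, B (a + (alpha *+ t + int_vec R m)) &
   exists2 v, is_limsup (queue^~ a) v & (orbit_visits B a t +
     fibre_index key B (a + (alpha *+ t + int_vec R m)) =
     v + fibre_index key A a)%N].

Lemma lebesgue_measurable_matched t m : lebesgue_measurable A ->
  lebesgue_measurable B -> lebesgue_measurable (matched t m).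
Proof.
move=> mA mB.
have mS C n : bounded_set C -> lebesgue_measurable C ->
    measurable_fun [set: T] (fun x : T => orbit_visits C x n).
  move=> bC mC; apply: measurable_fun_sumn => k.
  by apply: measurable_fun_shift; exact: measurable_hits.
have -> : matched t m = A `&` ([set a | B (a + (alpha *+ t + int_vec R m))] `&`
    \bigcup_v ([set a | is_limsup (queue^~ a) v] `&`
      [set a : T | (orbit_visits B a t +
     fibre_index key B (a + (alpha *+ t + int_vec R m)) =
     v + fibre_index key A a)%N])).
  apply/seteqP; split => [a [Aa Ba [v lv e]]|a [Aa [Ba [v _ [lv e]]]]].
    by split => //; split => //; exists v.
  by split => //; exists v.
apply: measurableI => //; apply: measurableI.
  exact: lebesgue_measurable_shift.
apply: bigcupT_measurable => v; apply: measurableI.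
  apply: lebesgue_measurable_limsup => n.
  apply: measurable_fun_subn; last exact: mS.
  by apply: measurable_fun_addn; [exact: mS|exact: measurable_cst].
apply: lebesgue_measurable_eqn; apply: measurable_fun_addn.
- exact: mS.
- by apply: measurable_fun_shift; exact: measurable_hits.
- exact: measurable_cst.
- exact: measurable_hits.
Qed.

Variables (X : set V) (L N : nat).
Hypothesis XG : forall x g, X x -> rotation_group alpha g -> X (x + g).
Hypothesis balanced : forall x n, X x ->
  (orbit_visits A x n <= orbit_visits B x n + K)%N /\
  (orbit_visits B x n <= orbit_visits A x n + K)%N.
Hypothesis few_visits : forall x, X x -> (K.*2 + visits A x <= L)%N.
Hypothesis many_visits : forall x, X x ->
  (L < orbit_visits A x N)%N /\ (L < orbit_visits B x N)%N.

Lemma invariant_forward x t : X x -> X (x + alpha *+ t).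
Proof.
move=> Xx; apply: XG => //; exists (Posz t), 0.
by rewrite [int_vec _ _]map_mx0 addr0 pmulrn.
Qed.

Lemma invariant_backward x t : X x -> X (x - alpha *+ t).
Proof.
move=> Xx; apply: XG => //; exists (- Posz t), 0.
by rewrite [int_vec _ _]map_mx0 addr0 mulrNz pmulrn.
Qed.

Lemma invariant_shift x m : X x -> X (x + int_vec R m).
Proof. by move=> Xx; apply: XG => //; exists 0, m; rewrite mulr0z add0r. Qed.

Lemma queue_limsup_ex x : X x -> exists v, is_limsup (queue^~ x) v.
Proof.
move=> Xx; apply: (@is_limsup_ex _ K.*2) => n; rewrite /queue.
by have [_] := balanced n Xx; lia.
Qed.

Lemma queue_limsup_le x v : X x -> is_limsup (queue^~ x) v -> (v <= K.*2)%N.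
Proof.
move=> Xx [io _]; have [n _ <-] := io 0%N; rewrite /queue.
by have [_] := balanced n Xx; lia.
Qed.

(** The queue grows by the visits to A and shrinks by the visits to B. *)
Lemma queue_limsup_forward x t v v' : X x -> is_limsup (queue^~ x) v ->
  is_limsup (queue^~ (x + alpha *+ t)) v' ->
  (v + orbit_visits A x t = v' + orbit_visits B x t)%N.
Proof.
move=> Xx; apply: (@is_limsup_shift _ _ t) => n.
have [] := balanced (t + n) Xx; have [] := balanced n (invariant_forward t Xx).
by rewrite /queue !orbit_visitsD; lia.
Qed.

Lemma queue_shift x m : queue^~ (x + int_vec R m) = queue^~ x.
Proof. by apply/funext => n; rewrite /queue !orbit_visits_shift. Qed.

Lemma matched_forward_ex a : X a -> A a ->
  exists t m, (t < N)%N /\ matched t m a.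
Proof.
move=> Xa Aa; have [v lv] := queue_limsup_ex Xa.
have vK := queue_limsup_le Xa lv.
have iA := fibre_index_lt keyD bA Aa.
have [t [j [tN jB e]]] : exists t j, [/\ (t < N)%N,
    (j < visits B (a + alpha *+ t)%R)%N &
    (orbit_visits B a t + j = v + fibre_index key A a)%N].
  apply: (@slot_exists (fun k => visits B (a + alpha *+ k))).
  have [_] := many_visits Xa; apply: leq_ltn_trans.
  by have := few_visits Xa; lia.
have [m Bm im] := fibre_index_surj keyD key_inj bB jB.
exists t, m; split => //; split => //; first by rewrite addrA.
by exists v => //; rewrite addrA im.
Qed.

Lemma matched_forward_unique a t m t' m' :
  matched t m a -> matched t' m' a -> t = t' /\ m = m'.
Proof.
move=> [Aa Bb [v lv e]] [_ Bb' [v' lv' e']].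
have vv : v = v' by exact: is_limsup_unique lv lv'.
move: Bb Bb' e e'; rewrite !addrA => Bb Bb' e e'; subst v'.
have jB := fibre_index_lt keyD bB Bb; have jB' := fibre_index_lt keyD bB Bb'.
rewrite visits_shift// in jB; rewrite visits_shift// in jB'.
have [|tt jj] := slot_unique (g := fun k => visits B (a + alpha *+ k)) jB jB'.
  by rewrite -/(orbit_visits B a t) e -e'.
by subst t'; split => //; exact: (fibre_index_inj keyD key_inj bB Bb Bb').
Qed.

(** Seen from the service b, time runs backward and the points of each fibre are
    numbered in the reverse order. The queue equation trades the queue length at
    a and the visits to B between a and b for the queue length v at b and the
    visits to A; the matching condition then says again that a prescribed number
    is the number of the customer a among the visits to A, so that the slot
    lemmas apply. *)
Lemma matched_backward b t m v : X b -> B b -> is_limsup (queue^~ b) v ->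
  A (b - (alpha *+ t + int_vec R m)) ->
  matched t m (b - (alpha *+ t + int_vec R m)) <->
  (\sum_(k < t) visits A (b - alpha *+ k) + (visits A (b - alpha *+ t) -
    (fibre_index key A (b - (alpha *+ t + int_vec R m))).+1) =
   v + visits A b - (fibre_index key B b).+1)%N.
Proof.
move=> Xb Bb lv; set a := b - _ => Aa.
have Xa : X a.
  by rewrite /a opprD addrA -int_vecN; exact/invariant_shift/invariant_backward.
have [w lw] := queue_limsup_ex Xa.
have ab : a + (alpha *+ t + int_vec R m) = b by rewrite subrK.
have lv' : is_limsup (queue^~ (a + alpha *+ t)) v.
  by rewrite -(queue_shift _ m) -addrA ab.
have cocycle := queue_limsup_forward Xa lw lv'.
have ea : a = b - alpha *+ t + int_vec R (- m) by rewrite int_vecN /a opprD addrA.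
have iA : (fibre_index key A a < visits A (b - alpha *+ t))%N.
  by rewrite -(visits_shift _ (- m))// -ea; exact: fibre_index_lt.
have iB := fibre_index_lt keyD bB Bb.
(* The queue is nonnegative after the services at b, hence the predecessor on the
   right-hand side of the claim is a genuine one. *)
have vB : (visits B b <= v + visits A b)%N.
  have [v1 lv1] := queue_limsup_ex (invariant_forward 1 Xb).
  by have := queue_limsup_forward Xb lv lv1; rewrite !orbit_visits1; lia.
have sumA : (orbit_visits A a t + visits A b =
    \sum_(k < t) visits A (b - alpha *+ k)%R + visits A (b - alpha *+ t)%R)%N.
  have := orbit_visits_backward A b t; rewrite big_ord_recr /= => <-.
  rewrite ea orbit_visits_shift// -[t.+1]addn1 orbit_visitsD subrK.
  by rewrite orbit_visits1.
rewrite /matched ab.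
split=> [[_ _ [w' lw' e]]|e].
  have ww := is_limsup_unique lw lw'; subst w'; move: e; lia.
by split=> //; exists w => //; lia.
Qed.

Lemma matched_backward_ex b : X b -> B b -> exists t m, (t < N)%N /\
  matched t m (b - (alpha *+ t + int_vec R m)).
Proof.
move=> Xb Bb; have [v lv] := queue_limsup_ex Xb.
have vK := queue_limsup_le Xb lv.
have iB := fibre_index_lt keyD bB Bb.
have [t [i [tN ih e]]] : exists t i, [/\ (t < N)%N,
    (i < visits A (b - alpha *+ t)%R)%N &
    (\sum_(k < t) visits A (b - alpha *+ k)%R + i =
     v + visits A b - (fibre_index key B b).+1)%N].
  apply: (@slot_exists (fun k => visits A (b - alpha *+ k))).
  have N0 : (0 < N)%N.
    by case: posnP (many_visits Xb).1 => // ->; rewrite /orbit_visits big_ord0.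
  have := orbit_visits_backward A b N.-1; rewrite prednK// => <-.
  apply: leq_ltn_trans (many_visits (invariant_backward N.-1 Xb)).1.
  by have := few_visits Xb; lia.
(* The customer with i others behind it in its fibre is looked for. *)
have [] := @fibre_index_surj _ _ key keyD key_inj A (b - alpha *+ t)
  (visits A (b - alpha *+ t) - i.+1) bA; first by lia.
move=> m Am im; exists t, (- m); split => //.
have em : b - (alpha *+ t + int_vec R (- m)) = b - alpha *+ t + int_vec R m.
  by rewrite int_vecN opprD opprK addrA.
apply/(matched_backward Xb Bb lv); rewrite em//.
by rewrite -e im; congr addn; lia.
Qed.

Lemma matched_backward_unique b t m t' m' : X b -> B b ->
  matched t m (b - (alpha *+ t + int_vec R m)) ->
  matched t' m' (b - (alpha *+ t' + int_vec R m')) -> t = t' /\ m = m'.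
Proof.
move=> Xb Bb M M'; have [v lv] := queue_limsup_ex Xb.
have [Aa _ _] := M; have [Aa' _ _] := M'.
have := proj1 (matched_backward Xb Bb lv Aa) M.
have := proj1 (matched_backward Xb Bb lv Aa') M'.
have ea u n : b - (alpha *+ u + int_vec R n) = b - alpha *+ u + int_vec R (- n).
  by rewrite int_vecN opprD addrA.
move: Aa Aa'; rewrite !ea => Aa Aa' e' e.
have iA := fibre_index_lt keyD bA Aa; have iA' := fibre_index_lt keyD bA Aa'.
rewrite visits_shift// in iA; rewrite visits_shift// in iA'.
have [| | |tt jj] := @slot_unique (fun k => visits A (b - alpha *+ k)) t
  (visits A (b - alpha *+ t) -
    (fibre_index key A (b - alpha *+ t + int_vec R (- m))).+1) t'
  (visits A (b - alpha *+ t') -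
    (fibre_index key A (b - alpha *+ t' + int_vec R (- m'))).+1).
- by lia.
- by lia.
- by rewrite e e'.
subst t'; split => //; apply: oppr_inj.
by apply: (fibre_index_inj keyD key_inj bA Aa Aa'); lia.
Qed.

End matching.

(** * Assembling the equidecomposition *)

Section assembly.
Context {R : realType} {d : nat}.
Local Notation V := 'rV[R]_d.
Implicit Types (A B X G : set V) (x y alpha : V).

Lemma equidecomposable_finType G A B X (I : finType) (P : I -> set V)
    (g : I -> V) :
  (forall i, lebesgue_measurable (P i)) -> (forall i, G (g i)) ->
  lebesgue_rV (~` X) = 0%E ->
  (forall i x, P i x -> A x /\ B (x + g i)) ->
  (forall x, X x -> A x -> exists i, P i x) ->
  (forall x i j, X x -> P i x -> P j x -> i = j) ->
  (forall y, X y -> B y -> exists i, P i (y - g i)) ->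
  (forall y i j, X y -> P i (y - g i) -> P j (y - g j) -> i = j) ->
  equidecomposable G A B.
Proof.
move=> mP Gg X0 PAB Aex Auniq Bex Buniq.
exists #|I|, (fun k => P (enum_val k)), (fun k => g (enum_val k)), X.
split => //; split.
- move=> k l _ _ [x [[Pk Xx] [Pl _]]]; apply: enum_val_inj.
  exact: (Auniq x).
- apply/seteqP; split => [x [k _ [/PAB[Ax _] Xx]]//|x [Ax Xx]].
  have [i Pi] := Aex x Xx Ax; exists (enum_rank i) => //.
  by rewrite enum_rankK.
- move=> k l _ _ [y [[[x Pk <-] Xy] [[x' Pl e] _]]]; apply: enum_val_inj.
  apply: (Buniq _ _ _ Xy); first by rewrite addrK.
  by rewrite -e addrK.
- apply/seteqP; split => [y [k _ [[x /PAB[_ Bx] <-] Xx]]//|y [By Xy]].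
  have [i Pi] := Bex y Xy By; exists (enum_rank i) => //; split => //.
  by rewrite enum_rankK; exists (y - g i) => //; rewrite subrK.
Qed.

Lemma lebesgue_outer_nullU A B : lebesgue_outer A = 0%E ->
  lebesgue_outer B = 0%E -> lebesgue_outer (A `|` B) = 0%E.
Proof.
move=> A0 B0; apply/eqP; rewrite eq_le lebesgue_outer_ge0 andbT.
have : (lebesgue_outer (A `|` B) <= lebesgue_outer A + lebesgue_outer B)%E.
  exact: outer_measureU2.
by rewrite A0 B0 adde0.
Qed.

Lemma equidecomposable_null G A B :
  lebesgue_rV A = 0%E -> lebesgue_rV B = 0%E -> equidecomposable G A B.
Proof.
move=> A0 B0; apply: (@equidecomposable_finType G A B (~` (A `|` B)) void
  (fun=> set0) (fun=> 0)); try by case.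
- by rewrite setCK; exact: lebesgue_outer_nullU.
- by move=> x nAB Ax; exfalso; apply: nAB; left.
- by move=> x nAB Bx; exfalso; apply: nAB; right.
Qed.

Lemma rotation_groupD alpha x y : rotation_group alpha x ->
  rotation_group alpha y -> rotation_group alpha (x + y).
Proof.
move=> [k [m ->]] [k' [m' ->]]; exists (k + k'), (m + m').
by rewrite mulrzDr int_vecD addrACA.
Qed.

(** The rotation group is countable and acts by measure preserving maps, so a
    property that holds almost everywhere holds on the whole orbit of almost every
    point. *)
Lemma null_rotation_saturation alpha (P : V -> Prop) :
  lebesgue_outer [set x | ~ P x] = 0%E ->
  lebesgue_outer (~` [set x | forall g, rotation_group alpha g -> P (x + g)])
    = 0%E.
Proof.
move=> P0; pose g (p : int * 'rV[int]_d) := alpha *~ p.1 + int_vec R p.2.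
have -> : ~` [set x | forall g, rotation_group alpha g -> P (x + g)] =
    \bigcup_p [set x | ~ P (x + g p)].
  apply/seteqP; split => [x /existsNP[h /not_implyP[[k [m ->]] nP]]|x [p _ nP]].
    by exists (k, m).
  by move=> /(_ (g p)) H; apply: nP; apply: H; exists p.1, p.2.
apply: lebesgue_outer_null_bigcup => p; rewrite -P0.
exact: (lebesgue_outer_shift [set x | ~ P x] (g p)).
Qed.

Lemma bounded_remainder_visits alpha A : bounded_remainder_set alpha A ->
  exists2 C : R, 0 <= C & lebesgue_outer [set x | ~ forall n,
    `|(orbit_visits alpha A x n)%:R - n%:R * fine (lebesgue_rV A)| <= C] = 0%E.
Proof.
move=> [bA _ [C [N [_ N0 badN]]]]; exists `|C| => //.
apply/eqP; rewrite eq_le lebesgue_outer_ge0 andbT -N0.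
apply: le_lebesgue_outer => x nx; apply: badN => good; apply: nx => -[|n].
  by rewrite /orbit_visits big_ord0 mul0r subrr normr0.
apply: le_trans (ler_norm C); rewrite /orbit_visits natr_sum.
have := good n.+1 isT; congr (`|_ - _| <= _).
by apply: eq_bigr => k _; exact: multiplicityE.
Qed.

Definition irrational_key alpha (m : 'rV[int]_d) : R :=
  \sum_(i < d) (m 0 i)%:~R * alpha 0 i.

Lemma irrational_keyD alpha : {morph irrational_key alpha : m m' / m + m'}.
Proof.
move=> m m'; rewrite /irrational_key -big_split; apply: eq_bigr => i _ /=.
by rewrite mxE intrD mulrDl.
Qed.

(** A collision of two integer vectors would be a rational relation between the
    coordinates of alpha. *)
Lemma irrational_key_inj alpha : totally_irrational alpha ->
  injective (irrational_key alpha).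
Proof.
move=> irr m m' e.
have [|_ q0] := irr 0 (fun i => (m 0 i)%:~R - (m' 0 i)%:~R).
  rewrite rmorph0 add0r; under eq_bigr do rewrite rmorphB /= !ratr_int mulrBl.
  by rewrite sumrB; apply/eqP; rewrite subr_eq0; apply/eqP.
by apply/rowP => i; apply/eqP; rewrite -(@eqr_int rat) -subr_eq0 (q0 i).
Qed.

End assembly.

Theorem theorem3p1 (R : realType) (d : nat) (alpha : 'rV[R]_d)
    (A B : set 'rV[R]_d) :
  (0 < d)%N ->
  totally_irrational alpha ->
  bounded_remainder_set alpha A ->
  bounded_remainder_set alpha B ->
  lebesgue_rV A = lebesgue_rV B ->
  equidecomposable (rotation_group alpha) A B.
Proof.
move=> _ irr brA brB muAB.
have [bA mA _] := brA; have [bB mB _] := brB.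
have [A0|A0] := eqVneq (lebesgue_rV A) 0%E.
  by apply: equidecomposable_null => //; rewrite -muAB.
have mu0 : 0 < fine (lebesgue_rV A).
  rewrite fine_gt0// lt0e A0 lebesgue_outer_ge0/=.
  exact: lebesgue_outer_bounded.
have [C1 C1_ge0 nullA] := bounded_remainder_visits brA.
have [C2 C2_ge0 nullB] := bounded_remainder_visits brB.
rewrite -muAB in nullB; set mu := fine _ in mu0 nullA nullB.
pose good x :=
  (forall n, `|(orbit_visits alpha A x n)%:R - n%:R * mu| <= C1) /\
  (forall n, `|(orbit_visits alpha B x n)%:R - n%:R * mu| <= C2).
pose X := [set x | forall g, rotation_group alpha g -> good (x + g)].
have goodX x : X x -> good x.
  move=> /(_ 0); rewrite addr0; apply; exists 0, 0.
  by rewrite mulr0z add0r [int_vec _ _]map_mx0.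
have X0 : lebesgue_outer (~` X) = 0%E.
  apply: null_rotation_saturation; apply/eqP.
  rewrite eq_le lebesgue_outer_ge0 andbT -(lebesgue_outer_nullU nullA nullB).
  by apply: le_lebesgue_outer => x /= /not_andP.
have XG x g : X x -> rotation_group alpha g -> X (x + g).
  by move=> Xx Gg h Gh; rewrite -addrA; apply: Xx; exact: rotation_groupD.
(* K bounds the difference of the two visit counts, so that the queue length is
   at most 2 K; L bounds the number of a customer, and a window of length N
   contains more than L visits to each set. *)
pose K := Num.bound (C1 + C2).
pose L := (K.*2 + Num.bound (C1 + mu))%N.
pose N := Num.bound ((L%:R + C1 + C2) / mu).
have balanced x n : X x ->
    (orbit_visits alpha A x n <= orbit_visits alpha B x n + K)%N /\
    (orbit_visits alpha B x n <= orbit_visits alpha A x n + K)%N.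
  move=> /goodX[/(_ n) + /(_ n)]; rewrite !ler_norml => /andP[a1 a2] /andP[b1 b2].
  have CK : C1 + C2 <= K%:R by apply/ltW/archi_boundP; rewrite addr_ge0.
  by split; rewrite -(ler_nat R) natrD; lra.
have few x : X x -> (K.*2 + visits A x <= L)%N.
  move=> /goodX[/(_ 1%N) + _]; rewrite orbit_visits1 mul1r ler_norml.
  move=> /andP[_ a2].
  rewrite leq_add2l -(ler_nat R).
  have : C1 + mu < (Num.bound (C1 + mu))%:R.
    by apply: archi_boundP; rewrite addr_ge0// ltW.
  lra.
have many x : X x -> (L < orbit_visits alpha A x N)%N /\
    (L < orbit_visits alpha B x N)%N.
  move=> /goodX[/(_ N) + /(_ N)]; rewrite !ler_norml => /andP[a1 a2] /andP[b1 b2].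
  have : (L%:R + C1 + C2) / mu < N%:R.
    by apply: archi_boundP; rewrite divr_ge0 ?addr_ge0 ?ler0n// ltW.
  rewrite ltr_pdivrMr// => LN.
  by split; rewrite -(ltr_nat R); lra.
have keyD := irrational_keyD alpha.
have keyI := irrational_key_inj irr.
have [MA AM] := bounded_set_norm_le bA; have [MB BM] := bounded_set_norm_le bB.
pose M := MB + MA + `|alpha| *+ N.
pose F := fset_set [set m : 'rV[int]_d | `|int_vec R m| <= M].
have inF t m a : (t < N)%N -> A a ->
    B (a + (alpha *+ t + int_vec R m)) -> m \in F.
  move=> tN Aa Bb; rewrite in_fset_set ?inE/=; last exact: finite_int_vec.
  have -> : int_vec R m = (a + (alpha *+ t + int_vec R m)) - a - alpha *+ t.
    by rewrite [a + _]addrC addrK addrC addKr.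
  apply: le_trans (ler_normB _ _) _; apply: lerD.
    by apply: le_trans (ler_normB _ _) _; apply: lerD; [exact: BM|exact: AM].
  by rewrite normrMn; apply: ler_wpMn2l => //; exact: ltnW.
pose g (p : 'I_N * F) := alpha *+ p.1 + int_vec R (val p.2).
pose P (p : 'I_N * F) := matched alpha (irrational_key alpha) A B K p.1 (val p.2).
apply: (@equidecomposable_finType _ _ _ _ _ X _ P g) => //.
- by move=> p; exact: lebesgue_measurable_matched.
- by move=> p; exists (Posz p.1), (val p.2); rewrite -pmulrn.
- by move=> p x [].
- move=> x Xx Ax.
  have [t [m [tN Mt]]] :=
    matched_forward_ex keyD keyI bA bB balanced few many Xx Ax.
  have [_ Bb _] := Mt; have mF := inF t m x tN Ax Bb.
  by exists (Ordinal tN, [` mF]%fset).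
- move=> x p q Xx Pp Pq.
  have [tt mm] := matched_forward_unique keyD keyI bB Pp Pq.
  by case: p q tt mm {Pp Pq} => [s u] [s' u'] /= /val_inj -> /val_inj ->.
- move=> y Xy By.
  have [t [m [tN Mt]]] :=
    matched_backward_ex keyD keyI bA bB XG balanced few many Xy By.
  have [Aa Bb _] := Mt; have mF := inF t m _ tN Aa Bb.
  by exists (Ordinal tN, [` mF]%fset).
- move=> y p q Xy Pp Pq.
  have By : B y by have [_ + _] := Pp; rewrite subrK.
  have [tt mm] :=
    matched_backward_unique keyD keyI bA bB XG balanced Xy By Pp Pq.
  by case: p q tt mm {Pp Pq} => [s u] [s' u'] /= /val_inj -> /val_inj ->.
Qed.
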